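(* Let $d\ge 2$ be fixed and let $\mathbf{p}_1,\dots,\mathbf{p}_n$ be independent points uniformly distributed in $[0,1]^d$. For $1\le k\le d$ let $M_{d,k}(n)$ be the number of $k$-dominant skyline points of $\{\mathbf{p}_1,\dots,\mathbf{p}_n\}$. Then, as $n\to\infty$, \[ \mathbb{E}[M_{d,k}(n)]\to\begin{cases}0,& \text{if } 1\le k\le d-1,\\ \infty, & \text{if } k=d.\end{cases} \]
   Context: For points $\mathbf{p}=(p_1,\dots,p_d)$, $\mathbf{q}=(q_1,\dots,q_d)$ of $\mathbb{R}^d$, $\mathbf{p}$ $k$-dominates $\mathbf{q}$ if there is a set $S$ of $k$ coordinates such that $p_j\le q_j$ for all $j\in S$ and $p_j<q_j$ for at least one $j\in S$. The $k$-dominant skyline of a finite set $\mathscr{D}$ is the set of points of $\mathscr{D}$ that are not $k$-dominated by any other point of $\mathscr{D}$. (For $k=d$ this is the usual skyline, i.e. the set of maximal/non-dominated points.) *)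

(* Defs.v *)
From HB Require Import structures.
From mathcomp Require Import all_boot all_order all_algebra finmap.
From mathcomp Require Import all_classical all_reals all_analysis.

Set Implicit Arguments.
Unset Strict Implicit.
Unset Printing Implicit Defensive.

Import Order.TTheory GRing.Theory Num.Theory.
Import numFieldNormedType.Exports.

Local Open Scope classical_set_scope.
Local Open Scope ring_scope.

(* Points of R^d are d-tuples, with the product (Borel) sigma-algebra that the
   library puts on d.-tuple R. *)

Definition k_dominates (R : realType) (d k : nat) (p q : d.-tuple R) : bool :=
  [exists S : {set 'I_d},
    [&& #|S| == k,
        [forall j in S, tnth p j <= tnth q j] &
        [exists j in S, tnth p j < tnth q j]]].

Definition k_dominant_skyline (R : realType) (d k : nat)
    (D : {fset d.-tuple R}) : {fset d.-tuple R} :=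
  [fset q in D | [forall p : D, (val p != q) ==> ~~ k_dominates k (val p) q]]%fset.

Definition skyline_count (R : realType) (d k n : nat) (T : Type)
    (p : 'I_n -> T -> d.-tuple R) (w : T) : R :=
  (#|` k_dominant_skyline k [fset p i w | i : 'I_n]%fset |)%:R.

(* The library's Lebesgue and uniform measures live on measurableTypeR R, which
   is R with the same sigma-algebra under another display. *)
Definition cons_pair (R : realType) (d : nat)
    (z : measurableTypeR R * d.-tuple R) :
  d.+1.-tuple R := [the d.+1.-tuple R of z.1 :: z.2].

Lemma measurable_cons_pair (R : realType) (d : nat) :
  measurable_fun [set: measurableTypeR R * d.-tuple R] (@cons_pair R d).
Proof. exact: measurable_cons. Qed.

HB.instance Definition _ (R : realType) (d : nat) :=
  isMeasurableFun.Build _ _ _ _ (@cons_pair R d) (@measurable_cons_pair R d).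

(* The d-fold product of the uniform probability on [0, 1], i.e. Lebesgue
   measure on [0,1]^d; see uniform_cube_box. *)
Fixpoint uniform_cube (R : realType) (d : nat) : probability (d.-tuple R) R :=
  match d with
  | 0%N => \d_ [tuple]
  | m.+1 => distribution (uniform_prob (@ltr01 R) \x uniform_cube R m)%E
              (@cons_pair R m)
  end.

Lemma uniform_cube_box (R : realType) (d : nat) (A : 'I_d -> set R) :
  (forall j, measurable (A j)) ->
  uniform_cube R d [set x | forall j, A j (tnth x j)] =
  (\prod_(j < d) uniform_prob (@ltr01 R) (A j))%E.
Proof.
elim: d A => [|d IHd] A mA.
  by rewrite big_ord0 /= diracE mem_set// => -[].
pose B := [set x : d.-tuple R | forall j, A (lift ord0 j) (tnth x j)].
have mB : measurable B.
  have -> : B = \bigcap_(j in [set: 'I_d])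
      ((fun x : d.-tuple R => tnth x j) @^-1` A (lift ord0 j)).
    by apply/seteqP; split=> x /= Bx j => [_|]; exact: Bx.
  apply: fin_bigcap_measurable; first exact: finite_finset.
  by move=> j _; rewrite -[X in measurable X]setTI; exact: measurable_tnth.
rewrite big_ord_recl/= -IHd// /distribution/= /pushforward.
rewrite -product_measure1E; [|exact: mA|exact: mB].
congr (_ _); apply/seteqP; split => -[x y] /=.
  move=> Axy; split; first exact: (Axy ord0).
  by move=> j; have := Axy (lift ord0 j); rewrite /cons_pair/= tnthS.
move=> [A0 A1] j; case: (unliftP ord0 j) => [i ->|-> //].
by rewrite /cons_pair/= tnthS; exact: A1.
Qed.

(* Laws are compared on measurable sets only: off them the values of
   pushforwards and of product measures carry no meaning. *)
Definition uniform_in_cube (R : realType) (d : nat) (disp : measure_display)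
    (T : measurableType disp) (P : probability T R)
    (X : {RV P >-> d.-tuple R}) : Prop :=
  forall B : set (d.-tuple R), measurable B ->
    distribution P X B = uniform_cube R d B.

Definition mutually_independent (R : realType) (I : finType)
    (disp disp' : measure_display) (T : measurableType disp)
    (T' : measurableType disp') (P : probability T R)
    (X : I -> {RV P >-> T'}) : Prop :=
  forall (J : {set I}) (B : I -> set T'), (forall i, measurable (B i)) ->
    P (\bigcap_(i in [set` J]) (X i @^-1` B i)) =
    (\prod_(i in J) P (X i @^-1` B i))%E.

(* Main.v *)
Require Import Defs.
From HB Require Import structures.
From mathcomp Require Import all_boot all_order all_algebra finmap.
From mathcomp Require Import all_classical all_reals all_analysis.
From mathcomp Require Import measurable_realfun.
From mathcomp Require Import ring lra zify.

Import Order.TTheory GRing.Theory Num.Theory.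
Import numFieldNormedType.Exports.

Local Open Scope classical_set_scope.
Local Open Scope ring_scope.

Set Implicit Arguments.
Unset Strict Implicit.

(** Let U be the uniform law.  For regions B and C, the probability that the
    i-th point lies in B while no other point lies in C is
    U(B) (1 - U(C))^(n-1), and both limits follow by summing such terms.

    For k = d, let B_a be the dyadic box in which the first two coordinates lie
    in ]x/2, x] and ]y/2, y], where x = 2^-a and y = 2^a / 2n, and let C_a be
    the region where these coordinates are at most x and y.  A point of B_a is
    dominated only by points of C_a, the B_a are disjoint, and each contributes
    at least 1/16 to the expectation, as soon as 2^m <= 2n for m boxes.

    For k < d, set K = (d - 1)(d + 1) and b = n^(-1/K), and cut each coordinate
    at the powers of b down to b^(2K) = n^-2.  If a point lies in a cell with
    upper corner (b^f_1, .., b^f_d), then every point below the lower corner in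
    all coordinates but c k-dominates it.  Choosing c with f_c maximal, that
    region has volume v with v^d >= b^((d-1)(S+d)), S being the sum of the f_j,
    and (1 - v)^(n-1) <= (d/nv)^d bounds the contribution of the cell by d^2 b.
    The number of cells does not depend on n. *)

(** * The uniform law on intervals, and measurability of boxes *)

Lemma uniform_prob01E (R : realType) (A : set R) : measurable A ->
  uniform_prob (@ltr01 R) A = lebesgue_measure (A `&` `[0, 1]).
Proof.
move=> mA; rewrite /uniform_prob integral_uniform_pdf.
rewrite (eq_integral (fun=> 1%:E)); last first.
  move=> x; rewrite inE/= in_itv/= /uniform_pdf => -[_ ->].
  by rewrite subr0 invr1.
by rewrite integral_cst ?mul1e//; exact: measurableI.
Qed.

Lemma uniform_prob01_itv (R : realType) (x y : R) :
  0 <= x -> x <= y -> y <= 1 ->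
  uniform_prob (@ltr01 R) `]x, y] = (y - x)%:E.
Proof.
move=> x0 xy y1; rewrite uniform_prob01E// setIidl; last first.
  move=> z /=; rewrite !in_itv/= => /andP[xz zy].
  by rewrite (le_trans zy y1) (le_trans x0 (ltW xz)).
rewrite lebesgue_measure_itv/= lte_fin; case: ltP => [//|yx].
by rewrite (le_anti (introT andP (conj xy yx))) subrr.
Qed.

Lemma uniform_prob01_itvNy (R : realType) (y : R) : 0 <= y -> y <= 1 ->
  uniform_prob (@ltr01 R) `]-oo, y] = y%:E.
Proof.
move=> y0 y1; rewrite uniform_prob01E//.
rewrite (_ : _ `&` _ = `[0, y]%classic).
  rewrite lebesgue_measure_itv/= lte_fin; case: ltP => [_|yx].
    by rewrite sube0.
  by rewrite -(le_anti (introT andP (conj y0 yx))).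
apply/seteqP; split=> z /=; rewrite !in_itv/=.
  by move=> [zy /andP[-> _]].
by move=> /andP[-> zy]; rewrite zy (le_trans zy y1).
Qed.

Lemma measurable_box (R : realType) (d : nat) (A : 'I_d -> set R) :
  (forall j, measurable (A j)) ->
  measurable [set x : d.-tuple R | forall j, A j (tnth x j)].
Proof.
move=> mA.
have -> : [set x : d.-tuple R | forall j, A j (tnth x j)] =
    \bigcap_(j in [set: 'I_d]) ((fun x : d.-tuple R => tnth x j) @^-1` A j).
  by apply/seteqP; split=> x /= Bx j => [_|]; exact: Bx.
apply: fin_bigcap_measurable; first exact: finite_finset.
by move=> j _; rewrite -[X in measurable X]setTI; exact: measurable_tnth.
Qed.

(* No measurability is assumed: the integral of a nonnegative function is a
   supremum over the simple functions below it. *)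
Lemma ge0_le_integral_simple (R : realType) (disp : measure_display)
    (T : measurableType disp) (mu : {measure set T -> \bar R})
    (f g : T -> \bar R) :
  (forall x, 0%E <= f x)%E -> (forall x, f x <= g x)%E ->
  (\int[mu]_x f x <= \int[mu]_x g x)%E.
Proof.
move=> f0 fg; rewrite !ge0_integralTE//; last first.
  by move=> x; exact: le_trans (f0 x) (fg x).
apply: ereal_sup_le => _ /= [h hf <-].
by exists h => // x; exact: le_trans (hf x) (fg x).
Qed.

(** * Events in which one point hits a region and all others avoid another *)

Definition only_hit (R : realType) (d n : nat) (T : Type)
    (X : 'I_n -> T -> d.-tuple R) (B C : set (d.-tuple R)) (i : 'I_n) : set T :=
  [set w | B (X i w) /\ forall l, l != i -> ~ C (X l w)].

Section only_hit.
Context (R : realType) (d n : nat) (disp : measure_display)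
  (T : measurableType disp) (P : probability T R)
  (X : 'I_n -> {RV P >-> d.-tuple R}).
Hypothesis X_uniform : forall i, uniform_in_cube (X i).
Hypothesis X_indep : mutually_independent X.

Let slot (B C : set (d.-tuple R)) (i l : 'I_n) := if l == i then B else ~` C.

(** One condition per index puts the event in the form of an intersection to which mutual
    independence applies. *)
Let only_hitE B C i : only_hit X B C i =
  \bigcap_(l in [set` [set: 'I_n]%SET]) (X l @^-1` slot B C i l).
Proof.
apply/seteqP; split=> w /=.
  move=> [Bw Cw] l _; rewrite /slot/=; case: eqP => [->//|/eqP]; exact: Cw.
move=> sw; split=> [|l /negbTE li].
  by have := sw i (finset.in_setT _); rewrite /slot/= eqxx.
by have := sw l (finset.in_setT _); rewrite /slot/= li.
Qed.

Let measurable_slot B C i l : measurable B -> measurable C ->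
  measurable (slot B C i l).
Proof.
by move=> mB mC; rewrite /slot; case: ifP => // _; exact: measurableC.
Qed.

Lemma measurable_only_hit B C i : measurable B -> measurable C ->
  measurable (only_hit X B C i).
Proof.
move=> mB mC; rewrite only_hitE; apply: fin_bigcap_measurable.
  exact: finite_finset.
by move=> l _; rewrite -[X in measurable X]setTI; apply: measurable_funPT => //;
  exact: measurable_slot.
Qed.

Lemma probability_only_hit B C (u v : R) i : measurable B -> measurable C ->
  uniform_cube R d B = u%:E -> uniform_cube R d C = v%:E ->
  P (only_hit X B C i) = (u * (1 - v) ^+ n.-1)%:E.
Proof.
move=> mB mC Bu Cv; rewrite only_hitE X_indep; last first.
  by move=> l; exact: measurable_slot.
rewrite (bigD1 i) ?finset.in_setT//= {1}/slot eqxx.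
have -> : P (X i @^-1` B) = u%:E by rewrite -Bu -(X_uniform i).
rewrite (eq_bigr (fun=> (1 - v)%:E)); last first.
  move=> l /andP[_ /negbTE li]; rewrite /slot li.
  transitivity (uniform_cube R d (~` C)).
    by rewrite -(X_uniform l)//; exact: measurableC.
  by rewrite probability_setC// Cv.
rewrite prodEFin -EFinM; congr (_ * _)%:E.
rewrite prodr_const; congr (_ ^+ _).
rewrite -[n in RHS]card_ord -(cardC1 i); apply: eq_card => l.
by rewrite [LHS]unfold_in/= finset.in_setT.
Qed.

(** By linearity, and since the probability of the event does not depend on [i], the inner sum
    contributes a factor [n]. *)
Lemma expectation_sum_only_hit (A : finType) (B C : A -> set (d.-tuple R))
    (u v : A -> R) :
  (forall a, measurable (B a)) -> (forall a, measurable (C a)) ->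
  (forall a, uniform_cube R d (B a) = (u a)%:E) ->
  (forall a, uniform_cube R d (C a) = (v a)%:E) ->
  ('E_P[(fun w => \sum_a \sum_i \1_(only_hit X (B a) (C a) i) w)%R] =
   (\sum_a n%:R * (u a * (1 - v a) ^+ n.-1))%R%:E)%E.
Proof.
move=> mB mC Bu Cv; rewrite unlock.
under eq_integral => w _
  do (rewrite -sumEFin; under eq_bigr do rewrite -sumEFin).
have mh a i : measurable_fun [set: T]
    (EFin \o (\1_(only_hit X (B a) (C a) i) : T -> R)).
  by apply/measurable_EFinP/measurable_indic/measurable_only_hit.
rewrite ge0_integral_sum//; last 2 first.
- by move=> a; apply: emeasurable_sum => i; exact: mh.
- by move=> a w _; apply: sume_ge0 => i _; rewrite lee_fin.
rewrite -sumEFin; apply: eq_bigr => a _.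
rewrite ge0_integral_sum//; last by move=> i; exact: mh.
rewrite (eq_bigr (fun=> (u a * (1 - v a) ^+ n.-1)%:E)); last first.
  move=> i _; rewrite integral_indic//; last exact: measurable_only_hit.
  by rewrite setIT; exact: probability_only_hit.
by rewrite sumEFin sumr_const card_ord mulr_natl.
Qed.

End only_hit.

Lemma uniform_cube_box_EFin (R : realType) (d : nat) (A : 'I_d -> set R)
    (u : 'I_d -> R) :
  (forall j, measurable (A j)) ->
  (forall j, uniform_prob (@ltr01 R) (A j) = (u j)%:E) ->
  uniform_cube R d [set x | forall j, A j (tnth x j)] = (\prod_j u j)%:E.
Proof.
by move=> mA Au; rewrite uniform_cube_box// -prodEFin; apply: eq_bigr => j _.
Qed.

(** * Domination, and comparison of the skyline with sums of indicators *)

Lemma k_dominates_irr (R : realType) (d k : nat) (x : d.-tuple R) :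
  k_dominates k x x = false.
Proof.
apply/negbTE/existsP => -[S /and3P[_ _ /existsP[j]]].
by rewrite ltxx andbF.
Qed.

(** Any [k] coordinates other than [c] serve as [S]: there are enough since [k <= d.-1], and one of
    them is strict since [k >= 1]. *)
Lemma k_dominates_strict (R : realType) (d k : nat) (c : 'I_d)
    (x y : d.-tuple R) : (1 <= k <= d.-1)%N ->
  (forall j, j != c -> tnth x j < tnth y j) -> k_dominates k x y.
Proof.
move=> /andP[k1 kd] xy; pose s := take k (enum (predC1 c)).
have szs : size s = k.
  rewrite /s size_takel// -cardE cardC1 card_ord//.
have sc j : j \in s -> j != c by move/mem_take; rewrite mem_enum.
apply/existsP; exists [set j in s]%SET; apply/and3P; split.
- rewrite cardsE -szs; apply/eqP/card_uniqP.
  by rewrite take_uniq// enum_uniq.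
- by apply/forallP => j; apply/implyP; rewrite finset.inE => /sc /xy /ltW.
- have s0 : (0 < size s)%N by rewrite szs.
  have [j js] : exists j, j \in s.
    by case: (s) s0 => [//|j s' _]; exists j; exact: mem_head.
  by apply/existsP; exists j; rewrite finset.inE js/=; exact/xy/sc.
Qed.

(** Irreflexivity lets the quantifier run over all indices, including [i] and those of coinciding
    points. *)
Lemma in_k_dominant_skyline (R : realType) (d k n : nat)
    (x : 'I_n -> d.-tuple R) (i : 'I_n) :
  reflect (forall l, ~~ k_dominates k (x l) (x i))
    (x i \in k_dominant_skyline k [fset x l | l : 'I_n]%fset).
Proof.
rewrite /k_dominant_skyline !inE/= in_imfset//=.
apply: (iffP forallP) => [sky l|sky [_ /= /imfsetP[l _ ->]]]; last first.
  by rewrite sky implybT.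
have xl : x l \in [fset x l | l : 'I_n]%fset by rewrite in_imfset.
have /= := sky [` xl]%fset; case: eqP => //= ->.
by rewrite k_dominates_irr.
Qed.

(** A skyline point lies in some [B a], and no other point lies in [C a], as it would dominate. So
    each skyline index realises at least one event; coinciding points only lower the count. *)
Lemma skyline_count_le (R : realType) (d k n : nat) (T : Type)
    (p : 'I_n -> T -> d.-tuple R) (A : finType) (B C : A -> set (d.-tuple R)) :
  (forall y, exists2 a, B a y & forall z, C a z -> k_dominates k z y) ->
  forall w, skyline_count k p w <=
    \sum_a \sum_i \1_(only_hit p (B a) (C a) i) w.
Proof.
move=> BC w; rewrite exchange_big/=.
set sky := k_dominant_skyline k [fset p i w | i : 'I_n]%fset.
apply: (@le_trans _ _ (\sum_i (p i w \in sky)%:R)).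
  rewrite -natr_sum ler_nat -/sky.
  pose s := [seq p i w | i <- enum 'I_n & p i w \in sky].
  rewrite (_ : (\sum_i _)%N = size s); last first.
    by rewrite size_map size_filter -sumn_count sumnE big_map big_enum.
  apply: uniq_leq_size => [|y ysky]; first exact: fset_uniq.
  have : y \in [fset p i w | i : 'I_n]%fset.
    by move: ysky; rewrite !inE => /andP[].
  move=> /imfsetP[i _ yi]; subst y; apply/mapP; exists i => //.
  by rewrite mem_filter mem_enum andbT.
apply: ler_sum => i _; case: in_k_dominant_skyline => [sky_i|_]; last first.
  by apply: sumr_ge0 => a _; rewrite indicE.
have [a Ba Ca] := BC (p i w); rewrite (bigD1 a)//= indicE mem_set; last first.
  by split=> // l _ /Ca; apply/negP.
by rewrite lerDl; apply: sumr_ge0 => a' _; rewrite indicE.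
Qed.

(** Disjointness of the [B a] lets each index realise at most one event, and an index that does so
    gives a skyline point. *)
Lemma skyline_count_ge (R : realType) (d k n : nat) (T : Type)
    (p : 'I_n -> T -> d.-tuple R) (A : finType) (B C : A -> set (d.-tuple R)) :
  (forall a, B a `<=` C a) ->
  (forall a a' y, B a y -> B a' y -> a = a') ->
  (forall a y z, B a y -> k_dominates k z y -> C a z) ->
  forall w, \sum_a \sum_i \1_(only_hit p (B a) (C a) i) w <=
    skyline_count k p w.
Proof.
move=> BC Bdisj Cdom w; rewrite exchange_big/=.
pose good i := `[< exists a, only_hit p (B a) (C a) i w >].
apply: (@le_trans _ _ (\sum_i (good i)%:R)).
  apply: ler_sum => i _; rewrite /good; case: asboolP => [[a Ea]|nE].
    rewrite (bigD1 a)//= indicE mem_set//= big1 ?addr0// => a' a'a.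
    rewrite indicE memNset// => -[Ba' _]; case/eqP: a'a.
    by apply: Bdisj Ba' _; case: Ea.
  rewrite big1// => a _; rewrite indicE memNset// => Ea.
  by apply: nE; exists a.
pose s := [seq p i w | i <- enum 'I_n & good i].
rewrite -natr_sum ler_nat (_ : (\sum_i _)%N = size s); last first.
  by rewrite size_map size_filter -sumn_count sumnE big_map big_enum.
apply: uniq_leq_size => [|y /mapP[i]].
  (* Distinct good indices give distinct points: a copy of a point of [B a] would be another point
     in [C a]. *)
  rewrite map_inj_in_uniq; first by rewrite filter_uniq// enum_uniq.
  move=> i l; rewrite !mem_filter => /andP[/asboolP[a [Ba Ca]] _] _ il.
  apply/eqP/negPn/negP => nil; apply: (Ca l); first by rewrite eq_sym.
  by apply: BC; rewrite -il.
rewrite mem_filter => /andP[/asboolP[a [Ba Ca]] _] ->.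
apply/in_k_dominant_skyline => l; apply/negP => ldom.
have [li|/Ca] := eqVneq l i; last by apply; exact: Cdom ldom.
by move: ldom; rewrite li k_dominates_irr.
Qed.

(** * Inequalities behind the estimate for one cell *)

Lemma bernoulli_ge (R : realDomainType) (v : R) (q : nat) : 0 <= v ->
  1 + q%:R * v <= (1 + v) ^+ q.
Proof.
move=> v0; elim: q => [|q IH]; first by rewrite mul0r addr0 expr0.
rewrite exprS; have qv : 0 <= q%:R * v by rewrite mulr_ge0.
apply: (@le_trans _ _ ((1 + v) * (1 + q%:R * v))); last first.
  by apply: ler_wpM2l => //; lra.
by rewrite -natr1; nra.
Qed.

Lemma bernoulli_sub_ge (R : realDomainType) (v : R) (q : nat) : 0 <= v <= 1 ->
  1 - q%:R * v <= (1 - v) ^+ q.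
Proof.
move=> /andP[v0 v1]; elim: q => [|q IH]; first by rewrite mul0r subr0 expr0.
rewrite exprS; have qv : 0 <= q%:R * v by rewrite mulr_ge0.
apply: (@le_trans _ _ ((1 - v) * (1 - q%:R * v))); last first.
  by apply: ler_wpM2l => //; lra.
by rewrite -natr1; nra.
Qed.

(** Bernoulli gives [(q + 1) v (1 - v)^q <= (1 + v)^q (1 - v)^q <= 1]. The bound is the [d]-th power
    of this, as [n <= d (q + 1)] and [d q <= n - 1]. *)
Lemma pow_1subr_decay (R : realFieldType) (v : R) (n d : nat) :
  (0 < d)%N -> 0 <= v <= 1 -> (n%:R * v) ^+ d * (1 - v) ^+ n.-1 <= d%:R ^+ d.
Proof.
move=> d0 /andP[v0 v1]; set q := (n.-1 %/ d)%N.
have w0 : 0 <= 1 - v by lra.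
have w1 : 1 - v <= 1 by lra.
have qn : (n <= d * q.+1)%N.
  have := ltn_ceil n.-1 d0; rewrite -/q; lia.
have q1 : q.+1%:R * v * (1 - v) ^+ q <= 1.
  apply: (@le_trans _ _ ((1 + v) ^+ q * (1 - v) ^+ q)); last first.
    by rewrite -exprMn; apply: exprn_ile1; nra.
  apply: ler_wpM2r; first exact: exprn_ge0.
  by apply: le_trans (bernoulli_ge _ v0); rewrite -natr1; lra.
apply: (@le_trans _ _ ((n%:R * v) ^+ d * ((1 - v) ^+ q) ^+ d)).
  apply: ler_wpM2l; first by rewrite exprn_ge0 ?mulr_ge0.
  by rewrite -exprM; apply: ler_wiXn2l => //; exact: leq_divM.
rewrite -exprMn; apply: lerXn2r; rewrite ?nnegrE ?mulr_ge0 ?exprn_ge0//.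
apply: (@le_trans _ _ (d%:R * (q.+1%:R * v * (1 - v) ^+ q))).
  rewrite !mulrA -natrM; do 2![apply: ler_wpM2r; rewrite ?exprn_ge0//].
  by rewrite ler_nat.
by rewrite -[leRHS]mulr1; apply: ler_wpM2l.
Qed.

(** The inequality is raised to the power [d - 1] and multiplied by [n b^((d-1)(S+d))]. As [v^d] is
    at least this power of [b], the left side is at most [b^(S(d-1)) (nv)^d Y], which the decay
    bound controls. *)
Lemma cell_contribution_le (R : realFieldType) (b : R) (n d S e : nat) :
  (2 <= d)%N -> 0 < b <= 1 -> n%:R * b ^+ (d.-1 * d.+1) = 1 ->
  (d * e <= d.-1 * (S + d))%N ->
  n%:R * (b ^+ S * (1 - b ^+ e) ^+ n.-1) <= d%:R ^+ 2 * b.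
Proof.
move=> d2 /andP[b0 b1] nb de; set v := b ^+ e; set Y := (1 - v) ^+ n.-1.
have bX m : 0 < b ^+ m by exact: exprn_gt0.
have v01 : 0 <= v <= 1 by rewrite ltW ?bX//= exprn_ile1// ltW.
have Y0 : 0 <= Y by rewrite exprn_ge0//; lra.
have Y1 : Y <= 1 by rewrite exprn_ile1//; lra.
have d1 : d.-1 != 0%N by lia.
set X := n%:R * (b ^+ S * Y).
have X0 : 0 <= X by rewrite !mulr_ge0// ltW.
have Z0 : 0 <= d%:R ^+ 2 * b by rewrite mulr_ge0 ?exprn_ge0// ltW.
rewrite -(ler_pXn2r (n := d.-1)) ?lt0n// ?nnegrE ?X0 ?Z0//.
have n0 : 0 < n%:R :> R.
  by rewrite -(pmulr_lgt0 _ (bX (d.-1 * d.+1)%N)) nb.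
(* Here [d <= 2 (d - 1)], so [d^d] is at most [(d^2)^(d-1)]. *)
apply: (@le_trans _ _ (d%:R ^+ d * b ^+ d.-1)); last first.
  rewrite exprMn; apply: ler_wpM2r; first exact: ltW.
  rewrite -exprM; apply: ler_weXn2l; last lia.
  by rewrite ler1n; lia.
rewrite -(ler_pM2r (bX (d.-1 * (S + d))%N)).
apply: (@le_trans _ _ (X ^+ d.-1 * v ^+ d)).
  apply: ler_wpM2l; first exact: exprn_ge0.
  by rewrite -exprM; apply: ler_wiXn2l; [exact: ltW|exact: b1|lia].
rewrite -(ler_pM2r n0).
apply: (@le_trans _ _ (b ^+ (S * d.-1) * ((n%:R * v) ^+ d * Y))).
  rewrite !exprMn (_ : n%:R ^+ d = n%:R ^+ d.-1 * n%:R); last first.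
    by rewrite -exprSr prednK//; lia.
  rewrite exprM.
  have YY : Y ^+ d.-1 <= Y.
    by rewrite -[leRHS]expr1; apply: ler_wiXn2l => //; lia.
  set p1 := n%:R ^+ _; set p2 := _ ^+ d.-1; set p3 := v ^+ d.
  rewrite (_ : p1 * _ * p3 * _ = (p1 * p2 * p3 * n%:R) * Y ^+ d.-1);
    last by ring.
  rewrite (_ : p2 * _ = (p1 * p2 * p3 * n%:R) * Y); last by ring.
  apply: ler_wpM2l => //.
  by rewrite !mulr_ge0// ?exprn_ge0// ?exprn_ge0// ltW//; case/andP: v01 => +.
apply: (@le_trans _ _ (b ^+ (S * d.-1) * d%:R ^+ d)).
  by apply: ler_wpM2l; [exact: ltW|apply: pow_1subr_decay => //; lia].
(* Both sides agree: [n b^((d-1)(d+1)) = 1] absorbs exactly the surplus exponent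
   [(d-1) + (d-1)d]. *)
rewrite -[leLHS]mulr1 -[X in _ * X <= _]nb le_eqVlt.
apply/orP; left; apply/eqP.
rewrite (_ : (d.-1 * (S + d) = S * d.-1 + d.-1 * d)%N); last by lia.
rewrite (_ : (d.-1 * d.+1 = d.-1 + d.-1 * d)%N); last by lia.
rewrite !exprD; ring.
Qed.

(** A maximal term is at least the average, so removing it leaves at most the fraction [(d - 1) / d]
    of the sum. *)
Lemma exists_sum_excl_le (d : nat) (f : 'I_d -> nat) : (0 < d)%N ->
  exists c, (d * \sum_(j | j != c) (f j).+1 <= d.-1 * (\sum_j f j + d))%N.
Proof.
have arith m F e : (F + e <= m * F -> m * e <= m.-1 * (F + e))%N.
  by case: m => [|m]; nia.
move=> d0; pose c := [arg max_(j > Ordinal d0) f j]%N.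
have fc j : (f j <= f c)%N by rewrite /c; case: arg_maxnP => // c' _; exact.
exists c.
have S1 : (\sum_j (f j).+1 = \sum_j f j + d)%N.
  under eq_bigr do rewrite -addn1.
  by rewrite big_split/= sum1_card card_ord.
have S2 : (\sum_j (f j).+1 <= d * (f c).+1)%N.
  rewrite -[X in (_ <= X * _)%N](card_ord d) -sum_nat_const.
  by apply: leq_sum => j _; rewrite ltnS.
move: S2; rewrite -S1 (bigD1 c)//=; set e := (\sum_(_ | _) _)%N.
exact: arith.
Qed.

(** * Monotonicity of expectation, and geometric cells of the line *)

Lemma le_expectation_ge0 (R : realType) (disp : measure_display)
    (T : measurableType disp) (P : probability T R) (f g : T -> R) :
  (forall w, 0 <= f w) -> (forall w, f w <= g w) -> ('E_P[f] <= 'E_P[g])%E.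
Proof.
move=> f0 fg; rewrite unlock.
by apply: ge0_le_integral_simple => w; rewrite lee_fin.
Qed.

(* Cell 0 is unbounded above, so that the cells below L cover ]b^L, +oo[. *)
Definition geometric_cell (R : realType) (b : R) (a : nat) : set R :=
  if a is 0%N then `]b, +oo[%classic else `]b ^+ a.+1, b ^+ a]%classic.

Lemma measurable_geometric_cell (R : realType) (b : R) (a : nat) :
  measurable (geometric_cell b a).
Proof. by case: a => [|a]; exact: measurable_itv. Qed.

Lemma geometric_cell_lb (R : realType) (b : R) (a : nat) (x : R) :
  geometric_cell b a x -> b ^+ a.+1 < x.
Proof.
by case: a => [|a] /=; rewrite in_itv/= ?andbT// => /andP[].
Qed.

(** The part of cell 0 above 1 has no mass, so one formula serves all cells. *)
Lemma uniform_prob01_cell (R : realType) (b : R) (a : nat) : 0 <= b <= 1 ->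
  uniform_prob (@ltr01 R) (geometric_cell b a) = (b ^+ a - b ^+ a.+1)%:E.
Proof.
move=> /andP[b0 b1]; case: a => [|a].
  rewrite /geometric_cell -setCitvl probability_setC//.
  by rewrite [X in (_ - X)%E]uniform_prob01_itvNy// expr0.
rewrite /geometric_cell uniform_prob01_itv ?exprn_ge0//.
- by apply: ler_wiXn2l.
- exact: exprn_ile1.
Qed.

(** The least [e] with [b ^+ e < x] determines the cell: its index is [e - 1], or 0 if [e = 0]. *)
Lemma geometric_cell_cover (R : realType) (b : R) (L : nat) (x : R) :
  b <= 1 -> (0 < L)%N -> b ^+ L < x -> exists a : 'I_L, geometric_cell b a x.
Proof.
move=> b1 L0 bx; have ex : exists e, b ^+ e < x by exists L.
case: (ex_minnP ex) => -[|e] be emin.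
  exists (Ordinal L0); rewrite /= in_itv/= andbT.
  by apply: le_lt_trans be; rewrite expr0.
have eL : (e < L)%N by exact: emin.
exists (Ordinal eL); rewrite /geometric_cell/=.
case: e be emin {eL} => [|e] be emin /=; rewrite in_itv/= be ?andbT//=.
by rewrite leNgt; apply/negP => /emin; rewrite ltnn.
Qed.

(** * Upper bound for the expectation when [k < d] *)

Section upper_bound.
Context (R : realType) (d n k : nat) (disp : measure_display)
  (T : measurableType disp) (P : probability T R)
  (X : 'I_n -> {RV P >-> d.-tuple R}).
Hypothesis X_uniform : forall i, uniform_in_cube (X i).
Hypothesis X_indep : mutually_independent X.

(** The term with [L ^ d] comes from the cells, the other from [d] slabs near the faces, where some
    coordinate is at most [b ^+ L]. *)
Lemma expectation_skyline_le (b : R) (L := (2 * (d.-1 * d.+1))%N) :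
  (2 <= d)%N -> (1 <= k <= d.-1)%N -> 0 < b <= 1 ->
  n%:R * b ^+ (d.-1 * d.+1) = 1 ->
  ('E_P[skyline_count k X] <= (((L ^ d)%:R * d%:R ^+ 2 + d%:R) * b)%:E)%E.
Proof.
move=> d2 kd b01 nb; have /andP[b0 b1] := b01.
have L0 : (0 < L)%N by rewrite /L; lia.
have [c cP] : {c : {ffun 'I_d -> 'I_L} -> 'I_d & forall f,
    (d * \sum_(j | j != c f) (f j).+1 <= d.-1 * (\sum_j f j + d))%N}.
  apply: (@choice _ _ (fun (f : {ffun 'I_d -> 'I_L}) (c : 'I_d) =>
    (d * \sum_(j | j != c) (f j).+1 <= d.-1 * (\sum_j f j + d))%N)) => f.
  by apply: exists_sum_excl_le; lia.
(* [inl f] stands for a cell and [inr i] for the slab of coordinate [i]. With [C] empty on slabs,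
   every point of a slab is counted. *)
pose A : finType := ({ffun 'I_d -> 'I_L} + 'I_d)%type.
pose Bs (a : A) (j : 'I_d) : set R := match a with
  | inl f => geometric_cell b (f j)
  | inr i => if j == i then `]-oo, b ^+ L]%classic else setT end.
pose Cs (f : {ffun 'I_d -> 'I_L}) (j : 'I_d) : set R :=
  if j == c f then setT else `]-oo, b ^+ (f j).+1]%classic.
pose B (a : A) := [set y : d.-tuple R | forall j, Bs a j (tnth y j)].
pose C (a : A) := if a is inl f
  then [set y : d.-tuple R | forall j, Cs f j (tnth y j)] else set0.
pose u (a : A) : R := match a with
  | inl f => \prod_j (b ^+ f j - b ^+ (f j).+1) | inr _ => b ^+ L end.
pose v (a : A) : R := match a with
  | inl f => b ^+ (\sum_(j | j != c f) (f j).+1) | inr _ => 0 end.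
have bX m : 0 <= b ^+ m <= 1.
  by rewrite exprn_ge0 ?exprn_ile1// ltW.
have mBs a j : measurable (Bs a j).
  by case: a => [f|i] /=; [exact: measurable_geometric_cell|case: ifP].
have mCs f j : measurable (Cs f j) by rewrite /Cs; case: ifP.
have mB a : measurable (B a) by exact: measurable_box.
have mC a : measurable (C a) by case: a => [f|i] //=; exact: measurable_box.
have Bu a : uniform_cube R d (B a) = (u a)%:E.
  case: a => [f|i].
    by apply: uniform_cube_box_EFin => // j; rewrite uniform_prob01_cell// ltW.
  rewrite (uniform_cube_box_EFin
    (u := fun j => if j == i then b ^+ L else 1))//.
    by rewrite -big_mkcond/= big_pred1_eq.
  move=> j /=; case: ifP => _; last exact: probability_setT.
  by case/andP: (bX L) => *; exact: uniform_prob01_itvNy.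
have Cv a : uniform_cube R d (C a) = (v a)%:E.
  case: a => [f|i]; last by rewrite /= measure0.
  rewrite (uniform_cube_box_EFin
    (u := fun j => if j != c f then b ^+ (f j).+1 else 1))//.
    by rewrite -big_mkcond/= prodrXr.
  move=> j; rewrite /Cs; case: eqP => _ /=; first exact: probability_setT.
  by case/andP: (bX (f j).+1) => *; exact: uniform_prob01_itvNy.
apply: le_trans (_ : _ <= 'E_P[(fun w => \sum_a \sum_i
    \1_(only_hit X (B a) (C a) i) w)%R])%E _.
  apply: le_expectation_ge0 => [w|]; first by rewrite /skyline_count.
  apply: skyline_count_le => y.
  have [[i yi]|ny] := pselect (exists i, tnth y i <= b ^+ L).
    exists (inr i) => // j /=; case: eqP => [->|//].
    by rewrite /= in_itv.
  have [g gP] : {g : 'I_d -> 'I_L &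
      forall j, geometric_cell b (g j) (tnth y j)}.
    apply: (@choice _ _ (fun (j : 'I_d) (a : 'I_L) =>
      geometric_cell b a (tnth y j))).
    move=> j; apply: geometric_cell_cover => //.
    by rewrite ltNge; apply/negP => yj; apply: ny; exists j.
  exists (inl (finfun g)) => [j|z /= Cz]; first by rewrite /= ffunE.
  apply: (@k_dominates_strict _ _ _ (c (finfun g))) => // j /negbTE jc.
  have := Cz j; rewrite /Cs jc/= in_itv/= ffunE => /le_lt_trans; apply.
  exact: geometric_cell_lb.
rewrite (expectation_sum_only_hit X_uniform X_indep mB mC Bu Cv) lee_fin.
rewrite big_sumType/= mulrDl; apply: lerD.
  apply: (@le_trans _ _ (\sum_(f : {ffun 'I_d -> 'I_L}) d%:R ^+ 2 * b)).
    apply: ler_sum => f _.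
    apply: le_trans (cell_contribution_le d2 b01 nb (cP f)).
    apply: ler_wpM2l => //; apply: ler_wpM2r.
      by apply: exprn_ge0; rewrite subr_ge0;
        case/andP: (bX (\sum_(j | j != c f) (f j).+1)%N).
    (* The volume of a cell is at most the product of its upper corner's coordinates. *)
    rewrite -prodrXr; apply: ler_prod => j _.
    rewrite subr_ge0 ler_wiXn2l ?(ltW b0)//= gerBl.
    by case/andP: (bX (f j).+1).
  by rewrite sumr_const card_ffun !card_ord -[leLHS]mulr_natl mulrA.
rewrite subr0 expr1n mulr1 sumr_const card_ord -[leLHS]mulr_natl.
apply: ler_wpM2l => //.
(* Since [L] is twice the exponent in [nb], one half cancels [n] and the other leaves at most
   [b]. *)
rewrite /L mul2n -addnn exprD mulrA nb mul1r -[leRHS]expr1.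
by apply: ler_wiXn2l => //; [exact: ltW|lia].
Qed.

End upper_bound.

(** * Lower bound for the expectation when [k = d] *)

Section lower_bound.
Context (R : realType) (d n : nat) (disp : measure_display)
  (T : measurableType disp) (P : probability T R)
  (X : 'I_n -> {RV P >-> d.+2.-tuple R}).
Hypothesis X_uniform : forall i, uniform_in_cube (X i).
Hypothesis X_indep : mutually_independent X.

(** A box [B a] has volume [1/8n], so it holds [1/8] point on average; [C a] has volume [1/2n], so
    the other points avoid it with probability at least [1/2] by Bernoulli. *)
Lemma expectation_skyline_ge (m : nat) : (0 < n)%N -> (2 ^ m <= 2 * n)%N ->
  ((m%:R / 16)%:E <= 'E_P[skyline_count d.+2 X])%E.
Proof.
move=> n0 mn.
have n0R : 0 < n%:R :> R by rewrite ltr0n.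
pose i1 : 'I_d.+2 := lift ord0 ord0.
pose x (a : 'I_m) : R := (2 ^+ a)^-1.
pose y (a : 'I_m) : R := 2 ^+ a / (2 * n%:R).
have x0 a : 0 < x a by rewrite invr_gt0 exprn_gt0.
have y0 a : 0 < y a by rewrite divr_gt0 ?exprn_gt0 ?mulr_gt0.
have x1 a : x a <= 1 by rewrite invf_le1 ?exprn_gt0// exprn_ege1// ler1n.
have y1 a : y a <= 1.
  rewrite ler_pdivrMr ?mulr_gt0// mul1r -natrX -natrM ler_nat.
  by apply: leq_trans mn; rewrite leq_exp2l// ltnW.
have xy a : x a * y a = (2 * n%:R)^-1.
  by rewrite /x /y mulrA mulVf ?mul1r// gt_eqF// exprn_gt0.
pose box (I J : set R) (j : 'I_d.+2) : set R :=
  if j == ord0 then I else if j == i1 then J else setT.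
pose B a := [set z : d.+2.-tuple R |
  forall j, box `]x a / 2, x a]%classic `]y a / 2, y a]%classic j (tnth z j)].
pose C a := [set z : d.+2.-tuple R |
  forall j, box `]-oo, x a]%classic `]-oo, y a]%classic j (tnth z j)].
have mbox (I J : set R) j :
    measurable I -> measurable J -> measurable (box I J j).
  by rewrite /box; case: ifP => //; case: ifP.
have boxE (I J : set R) (r s : R) : measurable I -> measurable J ->
    uniform_prob (@ltr01 R) I = r%:E -> uniform_prob (@ltr01 R) J = s%:E ->
    uniform_cube R d.+2 [set z | forall j, box I J j (tnth z j)] = (r * s)%:E.
  move=> mI mJ Ir Js.
  rewrite (uniform_cube_box_EFin (u := fun j : 'I_d.+2 =>
    if j == ord0 then r else if j == i1 then s else 1)).
  - by rewrite !big_ord_recl/= big1 ?mulr1.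
  - by move=> j; exact: mbox.
  - move=> j; rewrite /box; case: ifP => // _; case: ifP => // _.
    exact: probability_setT.
have mB a : measurable (B a) by apply: measurable_box => j; exact: mbox.
have mC a : measurable (C a) by apply: measurable_box => j; exact: mbox.
have Bu a : uniform_cube R d.+2 (B a) = ((8 * n%:R)^-1)%:E.
  rewrite (boxE _ _ (x a / 2) (y a / 2))//.
  - congr EFin; rewrite mulrACA xy; field; exact: lt0r_neq0.
  - rewrite uniform_prob01_itv//; first by congr EFin; lra.
    + by rewrite divr_ge0// ltW.
    + by have := x0 a; lra.
  - rewrite uniform_prob01_itv//; first by congr EFin; lra.
    + by rewrite divr_ge0// ltW.
    + by have := y0 a; lra.
have Cv a : uniform_cube R d.+2 (C a) = ((2 * n%:R)^-1)%:E.
  rewrite -(xy a); apply: boxE => //.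
  - by rewrite uniform_prob01_itvNy// ltW.
  - by rewrite uniform_prob01_itvNy// ltW.
have Bx a z : B a z -> x a / 2 < tnth z ord0 <= x a.
  by move=> /(_ ord0); rewrite /box/= in_itv.
have By a z : B a z -> y a / 2 < tnth z i1 <= y a.
  by move=> /(_ i1); rewrite /box/= in_itv.
have CI a z : tnth z ord0 <= x a -> tnth z i1 <= y a -> C a z.
  move=> zx zy j; rewrite /box; case: eqP => [->|_]; first by rewrite /= in_itv.
  by case: eqP => [->|//]; rewrite /= in_itv.
apply: (@le_trans _ _ 'E_P[(fun w => \sum_a \sum_i
    \1_(only_hit X (B a) (C a) i) w)%R])%E; last first.
  apply: le_expectation_ge0 => [w|].
    by do 2![apply: sumr_ge0 => ? _]; rewrite indicE.
  apply: skyline_count_ge.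
  - move=> a z Bz; have /andP[_ ?] := Bx _ _ Bz; have /andP[_ ?] := By _ _ Bz.
    exact: CI.
  (* The first coordinate alone separates the boxes: [x a' <= x a / 2] when [a < a']. *)
  - have lt_disj (a a' : 'I_m) z : B a z -> B a' z -> (a < a')%N -> False.
      move=> /Bx /andP[az _] /Bx /andP[_ za'] aa'.
      have : x a / 2 < x a' by exact: lt_le_trans za'.
      rewrite /x -invfM -exprSr ltf_pV2 ?posrE ?exprn_gt0//.
      by rewrite ltr_eXn2l ?ltr1n// ltnS leqNgt aa'.
    move=> a a' z Ba Ba'; apply: val_inj => /=.
    by case: (ltngtP a a') => // aa'; [have := lt_disj _ _ _ Ba Ba' aa'|
      have := lt_disj _ _ _ Ba' Ba aa'].
  - move=> a z z' Ba /existsP[S /and3P[/eqP cS /forallP zz' _]].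
    (* For [k = d] the set [S] is forced to contain all coordinates. *)
    have {}cS : S = [set: 'I_d.+2]%SET.
      by apply/eqP; rewrite eqEcard finset.subsetT cardsT card_ord cS leqnn.
    have {}zz' j : tnth z' j <= tnth z j.
      by have := zz' j; rewrite cS finset.in_setT.
    have /andP[_ ?] := Bx _ _ Ba; have /andP[_ ?] := By _ _ Ba.
    by apply: CI; [exact: le_trans (zz' _) _|exact: le_trans (zz' _) _].
rewrite (expectation_sum_only_hit X_uniform X_indep mB mC Bu Cv) lee_fin.
rewrite sumr_const card_ord -[leRHS]mulr_natl ler_wpM2l//.
have nn : n%:R * (8 * n%:R)^-1 = 8^-1 :> R.
  by field; exact: lt0r_neq0.
rewrite mulrA nn (_ : 16^-1 = 8^-1 * 2^-1 :> R); last by field.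
rewrite ler_wpM2l//.
have v01 : 0 <= (2 * n%:R : R)^-1 <= 1.
  rewrite invr_ge0 mulr_ge0//= invf_le1 ?mulr_gt0// -natrM ler1n; lia.
apply: le_trans (bernoulli_sub_ge _ v01).
have : n.-1%:R * (2 * n%:R : R)^-1 <= 2^-1.
  rewrite ler_pdivrMr ?mulr_gt0// mulrA mulVf// mul1r ler_nat; lia.
lra.
Qed.

End lower_bound.

(** * Passage to the limit *)

Lemma cvg_root_inv_nat (R : realType) (K : nat) : (0 < K)%N ->
  n%:R^-1 `^ K%:R^-1 @[n --> \oo] --> (0 : R).
Proof.
move=> K0; apply/cvgr0Pnorm_le => e e0; near=> n.
have n0 : 0 <= n%:R^-1 :> R by rewrite invr_ge0.
rewrite ger0_norm ?powR_ge0// -(ler_pXn2r K0) ?nnegrE ?powR_ge0 ?(ltW e0)//.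
rewrite -powR_mulrn ?powR_ge0// -powRrM mulVf ?pnatr_eq0 ?lt0n_neq0// powRr1//.
have nK : ((Num.truncn (e ^- K)).+1 <= n)%N by near: n; exact: nbhs_infty_ge.
rewrite -[leRHS]invrK lef_pV2 ?posrE ?invr_gt0 ?exprn_gt0//; last first.
  by rewrite ltr0n; exact: leq_ltn_trans nK.
by apply: (le_trans (ltW (truncnS_gt _))); rewrite ler_nat.
Unshelve. all: by end_near.
Qed.

Unset Implicit Arguments.
Set Strict Implicit.

Theorem theorem1 (R : realType) (d : nat) (d_ge2 : (2 <= d)%N)
    (disp : nat -> measure_display)
    (T : forall n : nat, measurableType (disp n))
    (P : forall n : nat, probability (T n) R)
    (p : forall n : nat, 'I_n -> {RV (P n) >-> d.-tuple R})
    (p_uniform : forall (n : nat) (i : 'I_n), uniform_in_cube (p n i))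
    (p_indep : forall n : nat, mutually_independent (p n))
    (k : nat) (k_bounds : (1 <= k <= d)%N) :
  ((1 <= k <= d - 1)%N ->
    'E_(P n)[skyline_count k (p n)]%E @[n --> \oo] --> 0%E) /\
  (k = d ->
    'E_(P n)[skyline_count k (p n)]%E @[n --> \oo] --> +oo%E).
Proof.
split=> [kd|->].
  pose K := (d.-1 * d.+1)%N; have K0 : (0 < K)%N by rewrite /K; lia.
  pose c : R := ((2 * K) ^ d)%:R * d%:R ^+ 2 + d%:R.
  pose b (n : nat) : R := n%:R^-1 `^ K%:R^-1.
  apply: (@squeeze_cvge _ _ _ _ (fun=> 0%E) _ (fun n => (c * b n)%:E)).
  (* The relation [n b^K = 1] requires [n] to be nonzero. *)
  - near=> n; have n0 : (0 < n)%N by near: n; exact: nbhs_infty_gt.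
    have n0R : 0 < n%:R^-1 :> R by rewrite invr_gt0 ltr0n.
    apply/andP; split.
      by rewrite unlock; apply: integral_ge0 => w _; rewrite lee_fin ler0n.
    apply: expectation_skyline_le => //; first by rewrite -subn1.
      rewrite powR_gt0//= (_ : 1 = 1 `^ K%:R^-1); last by rewrite powR1.
      rewrite ge0_ler_powR ?nnegrE ?invr_ge0//.
      by rewrite invf_le1 ?ltr0n// ler1n.
    rewrite -powR_mulrn ?powR_ge0// -powRrM mulVf ?pnatr_eq0 ?lt0n_neq0//.
    by rewrite powRr1 ?ltW// mulfV// pnatr_eq0 -lt0n.
  - exact: cvg_cst.
  - apply: cvg_EFin; first by near=> n.
    by rewrite -[X in _ --> X](mulr0 c); apply: cvgM;
      [exact: cvg_cst|exact: cvg_root_inv_nat].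
case: d d_ge2 p p_uniform p_indep {k k_bounds} => [|[|d]]//.
move=> _ p p_uniform p_indep.
(* This [m] exceeds [16 |M|], so [m] boxes contribute at least [M]; they fit as soon as
   [2^m <= n]. *)
apply/cvgeyPge => M; pose m := (Num.truncn (16 * `|M|)).+1.
near=> n; have mn : (2 ^ m <= n)%N by near: n; exact: nbhs_infty_ge.
apply: le_trans (expectation_skyline_ge (p_uniform n) (p_indep n) (m := m) _ _).
- rewrite lee_fin ler_pdivlMr// mulrC.
  apply: le_trans (_ : 16 * `|M| <= _); first by rewrite ler_wpM2l// ler_norm.
  by rewrite ltW// truncnS_gt.
- by apply: leq_trans mn; rewrite expn_gt0.
- by apply: leq_trans mn _; rewrite leq_pmull.
Unshelve. all: by end_near.
Qed.
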